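(* Let $\mathbb{P}=(\mathcal{G},(\mathcal{D},\sqsubseteq),\delta)$ be a pattern multistructure and let $\mathcal{D}^*\subseteq\mathcal{D}$ be its set of support-closed descriptions. Then $\mathbb{P}_{ext}=ext[\mathcal{D}^*]$.
   Context: A pattern setup is a triple $(\mathcal{G},(\mathcal{D},\sqsubseteq),\delta)$ with $\mathcal{G}$ a set, $(\mathcal{D},\sqsubseteq)$ a poset and $\delta:\mathcal{G}\to\mathcal{D}$ a map. $ext(d)=\{g\in\mathcal{G}\mid d\sqsubseteq\delta(g)\}$; $ext[X]=\{ext(d)\mid d\in X\}$; $\mathbb{P}_{ext}=ext[\mathcal{D}]$; $cov(A)=\{d\in\mathcal{D}\mid\forall g\in A,\ d\sqsubseteq\delta(g)\}$; $cov^*(A)=\max(cov(A))$ (maximal elements w.r.t. $\sqsubseteq$). The setup is a pattern multistructure if $cov(A)=\{c\in\mathcal{D}\mid\exists x\in cov^*(A),\ c\sqsubseteq x\}$ for every $A\subseteq\mathcal{G}$. A description $d$ is support-closed if for every $c\in\mathcal{D}$ with $d\sqsubseteq c$, $c\neq d$, we have $ext(c)\subsetneq ext(d)$. *)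

(* Defs.v *)
From mathcomp Require Import all_boot all_order classical_sets.

Set Implicit Arguments.
Unset Strict Implicit.
Unset Printing Implicit Defensive.

Import Order.TTheory.

Local Open Scope classical_set_scope.
Local Open Scope order_scope.

Definition maximals (disp : Order.disp_t) (T : porderType disp) (X : set T) :
    set T :=
  [set x | X x /\ forall y, X y -> x <= y -> y = x].

Record pattern_setup := PatternSetup {
  object : Type;
  desc_display : Order.disp_t;
  description : porderType desc_display;
  delta : object -> description }.

Section PatternSetup.
Variable P : pattern_setup.
Implicit Types (A : set (object P)) (d c : description P).

Definition ext d : set (object P) := [set g | d <= delta g].

Definition definable_sets : set (set (object P)) := ext @` setT.

Definition cov A : set (description P) :=
  [set d | forall g, A g -> d <= delta g].

Definition cov_star A : set (description P) := maximals (cov A).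

(* [down X] is the order ideal generated by [X], that is
   [set c | exists x, X x /\ c <= x]. *)
Definition is_pattern_multistructure : Prop :=
  forall A, cov A = down (cov_star A).

Definition support_closed d : Prop :=
  forall c, d <= c -> c <> d -> ext c `<` ext d.

End PatternSetup.

Arguments definable_sets : clear implicits.

(* Main.v *)
(** Any [d] lies in [cov (ext d)], hence below some [x] maximal in [cov (ext d)].
    Then [ext x = ext d], and [x] is support-closed: a description above [x]
    with the same extent would also lie in [cov (ext d)]. *)
Require Import Defs.
From mathcomp Require Import all_boot all_order classical_sets.

Local Open Scope classical_set_scope.

Lemma ext_antitone {P : pattern_setup} {d c : description P} :
  (d <= c)%O -> ext c `<=` ext d.
Proof. by move=> dc g; apply: Order.POrderTheory.le_trans. Qed.

Lemma cov_star_ext_support_closed {P : pattern_setup} {d x : description P} :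
  (d <= x)%O -> cov_star (ext d) x -> ext x = ext d /\ support_closed x.
Proof.
move=> dx [covx maxx].
(* Unfolded, [cov A x] says that [A] is included in [ext x]; so [covx] is itself the inclusion of
   [ext d] in [ext x]. *)
have extE : ext x = ext d by apply/seteqP; split; [exact: ext_antitone | exact: covx].
split=> // c xc cx; split; first exact: ext_antitone.
(* By the same unfolding, the reverse inclusion [covc] is membership of [c] in [cov (ext d)]. *)
by rewrite extE => covc; apply: cx; apply: maxx.
Qed.

Theorem theorem7p6 (P : pattern_setup) (HP : is_pattern_multistructure P) :
  definable_sets P = @ext P @` [set d | support_closed d].
Proof.
apply/seteqP; split=> [_ [d _ <-]|_ [d _ <-]]; last by exists d.
have : cov (ext d) d by move=> g.
(* The hypothesis, taken at the set [ext d], provides a maximal [x] above [d]. *)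
rewrite HP => -[x [covx dx]].
by have [extE scx] := cov_star_ext_support_closed dx covx; exists x.
Qed.
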